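(* Let $G$ be a finite simple triangulated graph. Then $G$ is $S$-perfect if and only if $G$ contains no odd sun as an induced subgraph.
   Context: A graph is triangulated (chordal) if it has no induced cycle of length at least $4$. A star is a tree with one vertex adjacent to all other vertices ($K_1$ and $K_2$ count as stars). An $\mathbb{S}$-cover of $G$ is a family of stars that are subgraphs of $G$ such that every vertex of $G$ lies in at least one of them; $\theta_S(G)$ is the minimum size of an $\mathbb{S}$-cover. A set $T\subseteq V(G)$ is $S$-independent if no two vertices of $T$ lie in a common star subgraph of $G$ (equivalently, any two vertices of $T$ are at distance at least $3$); $\alpha_S(G)$ is the maximum size of an $S$-independent set. $G$ is $S$-perfect if $\alpha_S(H)=\theta_S(H)$ for every induced subgraph $H$ of $G$. A vertex is simplicial if it belongs to exactly one maximal clique (i.e., its neighbourhood is a clique). $k$-sun: let $H$ be a graph with a Hamiltonian cycle $C=v_1v_2\dots v_kv_1$ ($k\ge 3$); add new vertices $u_1,\dots,u_k$, with $u_i$ adjacent exactly to $v_i$ and $v_{i+1}$ (indices mod $k$), so each $u_i$ is simplicial. The resulting graph is a $k$-sun; it is an odd sun if $k$ is odd. *)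

(* Defs.v *)
From HB Require Import structures.
From mathcomp Require Import all_boot.

Set Implicit Arguments.
Unset Strict Implicit.
Unset Printing Implicit Defensive.

Record sgraph := SGraph {
  vertex :> finType;
  adj : rel vertex;
  adj_sym : symmetric adj;
  adj_irrefl : irreflexive adj }.

Section Induced.
Variables (G : sgraph) (A : {set G}).

Definition induced_adj : rel {x : G | x \in A} :=
  fun x y => adj (val x) (val y).

Lemma induced_adj_sym : symmetric induced_adj.
Proof. by move=> x y; apply: adj_sym. Qed.

Lemma induced_adj_irrefl : irreflexive induced_adj.
Proof. by move=> x; apply: adj_irrefl. Qed.

Definition induced : sgraph := SGraph induced_adj_sym induced_adj_irrefl.

End Induced.

Definition is_cycle (k : nat) (G : sgraph) : Prop :=
  exists2 c : 'I_k -> G, bijective c &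
    forall i j, adj (c i) (c j) = (j == ordS i) || (i == ordS j).

Definition triangulated (G : sgraph) : Prop :=
  forall (k : nat) (A : {set G}), 4 <= k -> ~ is_cycle k (induced A).

(* The bound on the length k of a cycle loses nothing: a cycle has no repeated
   vertex, so its length is at most #|G|. *)
Definition acyclic (G : sgraph) : bool :=
  [forall k : 'I_#|G|.+1, forall c : k.-tuple G,
     (3 <= k) && uniq c ==> ~~ cycle (@adj G) c].

Definition connected (G : sgraph) : bool :=
  (0 < #|G|) && [forall x : G, forall y : G, connect (@adj G) x y].

Definition tree (G : sgraph) : bool := connected G && acyclic G.

Definition star (G : sgraph) : bool :=
  tree G && [exists c : G, forall x : G, (x != c) ==> adj c x].

(* A pair (W, E) of a set of vertices and a set of unordered pairs of vertices;
   it is a subgraph of G only under the predicate is_subgraph below. *)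
Definition presubgraph (G : sgraph) : finType :=
  ({set G} * {set {set G}})%type.

Definition is_subgraph (G : sgraph) (S : presubgraph G) : bool :=
  [forall e in S.2,
     [exists x in S.1, [exists y in S.1, adj x y && (e == [set x; y])]]].

Section SubgraphGraph.
Variables (G : sgraph) (S : presubgraph G).

(* When is_subgraph S holds, S.2 contains no singleton, so that the conjunct
   x != y is redundant; it makes this a simple graph for every S. *)
Definition subgraph_adj : rel {x : G | x \in S.1} :=
  fun x y => (x != y) && ([set val x; val y] \in S.2).

Lemma subgraph_adj_sym : symmetric subgraph_adj.
Proof. by move=> x y; rewrite /subgraph_adj eq_sym setUC. Qed.

Lemma subgraph_adj_irrefl : irreflexive subgraph_adj.
Proof. by move=> x; rewrite /subgraph_adj eqxx. Qed.

Definition subgraph_graph : sgraph :=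
  SGraph subgraph_adj_sym subgraph_adj_irrefl.

End SubgraphGraph.

Definition star_subgraph (G : sgraph) (S : presubgraph G) : bool :=
  is_subgraph S && star (subgraph_graph S).

Definition S_cover (G : sgraph) (C : {set presubgraph G}) : bool :=
  [forall S in C, star_subgraph S] &&
  [forall x : G, exists S in C, x \in S.1].

Lemma star_subgraph1 (G : sgraph) (x : G) : star_subgraph ([set x], set0).
Proof.
have Px : x \in [set x] by rewrite inE.
pose S : presubgraph G := ([set x], set0).
have all1 (y : subgraph_graph S) : y = exist _ x Px.
  by apply: val_inj; case: y => y /= /set1P.
have card1 : #|subgraph_graph S| = 1.
  by apply/eqP/fintype1P; exists (exist _ x Px).
apply/andP; split; first by apply/forall_inP => e; rewrite inE.
apply/andP; split; last first.
  apply/existsP; exists (exist _ x Px); apply/forallP => y.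
  by rewrite (all1 y) eqxx.
apply/andP; split; last first.
  apply/forallP => k; apply/forallP => c; apply/implyP => /andP[k3 _].
  have := leq_trans k3 (ltn_ord k : k <= #|subgraph_graph S|).
  by move=> lt2; exfalso; move: lt2; rewrite card1.
rewrite /connected card1 /=; apply/forallP => y; apply/forallP => z.
by rewrite (all1 y) (all1 z).
Qed.

(* The default argument of the minimum in theta_S is itself an S-cover. *)
Lemma S_cover_all (G : sgraph) :
  S_cover [set S : presubgraph G | star_subgraph S].
Proof.
apply/andP; split; first by apply/forall_inP => S; rewrite inE.
apply/forallP => x; apply/exists_inP; exists ([set x], set0).
  by rewrite inE star_subgraph1.
by rewrite inE.
Qed.

Definition theta_S (G : sgraph) : nat :=
  #|[arg min_(C < [set S : presubgraph G | star_subgraph S] | S_cover C) #|C|]|.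

Definition S_independent (G : sgraph) (A : {set G}) : bool :=
  [forall x in A, forall y in A, (x != y) ==>
     ~~ [exists S : presubgraph G,
           [&& star_subgraph S, x \in S.1 & y \in S.1]]].

Definition alpha_S (G : sgraph) : nat :=
  \max_(A : {set G} | S_independent A) #|A|.

Definition S_perfect (G : sgraph) : Prop :=
  forall A : {set G}, alpha_S (induced A) = theta_S (induced A).

(* G is a k-sun: the v i carry an arbitrary graph having v_0 v_1 ... v_(k-1) as
   a Hamiltonian cycle, and the neighbours of u i are exactly v i and v (i+1),
   where ordS is the successor modulo k. *)
Definition is_sun (k : nat) (G : sgraph) : Prop :=
  3 <= k /\
  exists v u : 'I_k -> G,
    [/\ bijective (fun s : 'I_k + 'I_k =>
                     match s with inl i => v i | inr i => u i end),
        forall i, adj (v i) (v (ordS i)) &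
        forall i x, adj (u i) x = (x == v i) || (x == v (ordS i))].

Definition contains_odd_sun (G : sgraph) : Prop :=
  exists (k : nat) (A : {set G}), odd k /\ is_sun k (induced A).

(* Main.v *)
Require Import Defs.
From HB Require Import structures.
From mathcomp Require Import all_boot.
From mathcomp Require Import zify.

Set Implicit Arguments.
Unset Strict Implicit.
Unset Printing Implicit Defensive.

(* Stars are subgraphs of closed neighbourhoods, so theta_S is the domination
   number and alpha_S the maximum number of vertices with pairwise disjoint
   closed neighbourhoods.  In a k-sun every closed neighbourhood contains at
   least two of the v_i and at most two of the u_i, hence
   2 alpha_S <= k <= 2 theta_S and the two differ when k is odd.
   Conversely, in a triangulated graph a k-cycle submatrix of the closed
   neighbourhood matrix yields a k-sun, so without odd suns the matrix is
   balanced in the sense of Berge.  As for all balanced hypergraphs, vertex sets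
   (even with multiplicities) can then be coloured, with as many colours as the
   largest trace of a neighbourhood, injectively on each neighbourhood;
   Lovasz's averaging argument turns this into equality of packing and
   domination. *)

(** * Paths and chords in triangulated graphs *)

Definition near (G : sgraph) : rel G := fun x y => (x == y) || adj x y.

Definition nbhd (G : sgraph) (x : G) : {set G} := [set y | near x y].

Lemma near_sym (G : sgraph) : symmetric (@near G).
Proof. by move=> x y; rewrite /near eq_sym adj_sym. Qed.

Lemma near_refl (G : sgraph) : reflexive (@near G).
Proof. by move=> x; rewrite /near eqxx. Qed.

Lemma adj_near (G : sgraph) (x y : G) : adj x y -> near x y.
Proof. by rewrite /near orbC => ->. Qed.

Lemma adj_neq (G : sgraph) (x y : G) : adj x y -> x != y.
Proof. by apply: contraTneq => ->; rewrite adj_irrefl. Qed.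

Lemma near_adj (G : sgraph) (x y : G) : x != y -> near x y -> adj x y.
Proof. by rewrite /near; case: eqP. Qed.

Lemma ordS_eq (k : nat) (i j : 'I_k) :
  (j == ordS i) = (j == i.+1 :> nat) || ((i.+1 == k) && (j == 0 :> nat)).
Proof.
rewrite -val_eqE /=; have [lt_ik|] := ltnP i.+1 k.
  by rewrite modn_small // (ltn_eqF lt_ik) /= orbF.
move=> le_ki; have -> : i.+1 = k by apply/eqP; rewrite eqn_leq le_ki ltn_ord.
by rewrite modnn eqxx (ltn_eqF (ltn_ord j)).
Qed.

Lemma triangulated_cycle (G : sgraph) (k : nat) (c : 'I_k -> G) :
  triangulated G -> 4 <= k -> injective c ->
  (forall i j, adj (c i) (c j) = (j == ordS i) || (i == ordS j)) -> False.
Proof.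
move=> triG k4 c_inj adjc.
pose A := [set c i | i : 'I_k].
have cA i : c i \in A by apply: imset_f.
apply: (triG k A k4); pose d i : induced A := exist _ (c i) (cA i).
exists d => //; apply: inj_card_bij.
  by move=> i j /(congr1 val) /=; apply: c_inj.
by rewrite card_sig card_imset // cardE.
Qed.

Section ShortestPath.
Variables (T : finType) (e : rel T).

(** In a walk of least length, a repeated vertex or an edge jumping ahead by more than one place
    would allow a segment to be cut out. *)
Lemma shortest_path (x y : T) : connect e x y ->
  exists s : seq T, [/\ path e x s, last x s = y &
    forall i j, i < j -> j <= size s ->
      nth x (x :: s) i != nth x (x :: s) j /\
      (e (nth x (x :: s) i) (nth x (x :: s) j) -> j = i.+1)].
Proof.
move=> xy.
pose Q n := [exists t : n.-tuple T, path e x t && (last x t == y)].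
have Qs s : path e x s -> last x s = y -> Q (size s).
  by move=> es sy; apply/existsP; exists (in_tuple s); rewrite /= es sy eqxx.
have exQ : exists n, Q n.
  by case/connectP: xy => p ep yp; exists (size p); apply: Qs.
case: (ex_minnP exQ) => m /existsP[t /andP[et /eqP ty]] min_m.
exists t; split=> // i j lt_ij; rewrite size_tuple => le_jm.
have short s : path e x s -> last x s = y -> m <= size s.
  by move=> es sy; apply: min_m; apply: Qs.
have last_take n : n <= m -> last x (take n t) = nth x (x :: t) n.
  move=> le_nm; rewrite (last_nth x) size_takel ?size_tuple //; case: n le_nm => //= n le_nm.
  by rewrite nth_take.
have pt n : path e x (take n t) && path e (last x (take n t)) (drop n t).
  by rewrite -cat_path cat_take_drop.
have lt_im := leq_trans lt_ij le_jm.
split.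
  apply/negP => /eqP eq_ij.
  suff: m <= size (take i t ++ drop j t).
    by rewrite size_cat size_takel ?size_drop ?size_tuple; lia.
  have [/andP[pi _] /andP[_ dj]] := (pt i, pt j).
  apply: short.
    by rewrite cat_path pi last_take ?(ltnW lt_im) // eq_ij -last_take.
  rewrite last_cat last_take ?(ltnW lt_im) // eq_ij -last_take //.
  by rewrite -last_cat cat_take_drop.
case: j lt_ij le_jm => // j lt_ij le_jm eij.
apply/eqP; rewrite eqn_leq lt_ij andbT leqNgt; apply/negP => lt_ij'.
have dj : drop j t = nth x t j :: drop j.+1 t.
  by rewrite (drop_nth x) ?size_tuple.
suff: m <= size (take i t ++ drop j t).
  by rewrite size_cat size_takel ?size_drop ?size_tuple; lia.
have [/andP[pi _] /andP[_ pj]] := (pt i, pt j).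
apply: short.
  rewrite cat_path pi last_take ?(ltnW lt_im) // dj /= eij /=.
  by move: pj; rewrite dj /= => /andP[].
have := last_cat x (take j t) (drop j t).
by rewrite cat_take_drop last_cat dj /= => <-.
Qed.

End ShortestPath.

Definition avoiding (G : sgraph) (W : {set G}) (x y : G) : rel G :=
  [rel u v | [&& u \in W, v \in W, adj u v & [set u; v] != [set x; y]]].

(** [near] replaces [adj] because consecutive vertices of the walks built below may coincide, for
    instance when [z i = a i]. *)
Lemma avoiding_step (G : sgraph) (W : {set G}) (x y u v : G) :
  u \in W -> v \in W -> near u v ->
  ~ (u = x /\ v = y) -> ~ (u = y /\ v = x) -> connect (avoiding W x y) u v.
Proof.
move=> uW vW; rewrite /near; have [->|/eqP nuv] := eqVneq u v => //= uv n1 n2.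
apply: connect1; rewrite /avoiding /= uW vW uv /=; apply/eqP => Euv.
have: v \in [set x; y] by rewrite -Euv set22.
have: u \in [set x; y] by rewrite -Euv set21.
by rewrite !inE => /orP[]/eqP Eu /orP[]/eqP Ev; [case: nuv | case: n1 | case: n2 | case: nuv]; rewrite Eu Ev.
Qed.

(* The shortest walk from x to y avoiding the edge xy would close up with that
   edge to an induced cycle, so it has length 2. *)
Lemma common_neighbour (G : sgraph) (W : {set G}) (x y : G) :
  triangulated G -> adj x y ->
  connect (avoiding W x y) x y ->
  exists w, [&& w \in W, adj x w & adj w y].
Proof.
set e := avoiding W x y => triG xy /shortest_path[s [es ys sP]].
pose c i := nth x (x :: s) i.
have c0 : c 0 = x by [].
have cm : c (size s) = y by rewrite -ys (last_nth x).
have ce i : i < size s -> e (c i) (c i.+1).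
  by move=> lt_is; have /(pathP x) := es; apply.
have c_inj i j : i <= size s -> j <= size s -> c i = c j -> i = j.
  move=> le_i le_j eq_c; case: (ltngtP i j) => // lt_ij.
    by have [/eqP] := sP i j lt_ij le_j.
  by have [/eqP] := sP j i lt_ij le_i; rewrite -!/(c _) eq_c.
(* Length 1 would mean using the edge xy, which [avoiding] deletes. *)
have size_gt1 : 1 < size s.
  case Ds: (size s) => [|[|n]] //.
    by move: xy; rewrite -cm Ds c0 adj_irrefl.
  by have := ce 0; rewrite Ds -[1]Ds cm c0 /e /avoiding /= eqxx !andbF => /(_ (leqnn _)).
have [size2|size_neq2] := eqVneq (size s) 2.
  exists (c 1); have /and4P[_ -> a1 _] := ce 0 (ltnW size_gt1).
  by have := ce 1 size_gt1; rewrite -[in c 2]size2 cm => /and4P[_ _ -> _]; rewrite a1.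
have cW i : i <= size s -> c i \in W.
  case: i => [_|i lt_i]; last by case/and4P: (ce i lt_i).
  by case/and4P: (ce 0 (ltnW size_gt1)).
(* The edge xy is the only chord of the walk: any other chord would be an edge of [avoiding] and
   shorten it. *)
have adj_lt i j : i < j -> j <= size s ->
    adj (c i) (c j) = (j == i.+1) || (i == 0) && (j == size s).
  move=> lt_ij le_j; apply/idP/idP; last first.
    case/orP => [/eqP Dj|/andP[/eqP-> /eqP->]]; last by rewrite c0 cm.
    by rewrite Dj; have /and4P[] := ce i ltac:(lia).
  move=> aij; have [_ eij] := sP i j lt_ij le_j.
  have le_i : i <= size s := ltnW (leq_trans lt_ij le_j).
  have [|nxy] := eqVneq [set c i; c j] [set x; y]; last first.
    by rewrite eij ?eqxx // /e /avoiding /= -!/(c _) !cW ?aij.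
  have end_c n : n <= size s -> c n \in [set x; y] -> n = 0 \/ n = size s.
    move=> le_n; rewrite !inE -{1}c0 -cm => /orP[]/eqP/c_inj E; [left|right]; exact: E.
  move=> Exy; have: c i \in [set x; y] by rewrite -Exy set21.
  have: c j \in [set x; y] by rewrite -Exy set22.
  by move=> /end_c-/(_ le_j) ? /end_c-/(_ le_i) ?; lia.
pose d (i : 'I_(size s).+1) := c i.
exfalso; apply: (@triangulated_cycle G _ d) => //; first lia.
  by move=> i j /c_inj Eij; apply: val_inj; apply: Eij; rewrite -ltnS.
move=> i j; have [lt_i lt_j] := (ltn_ord i, ltn_ord j).
rewrite !ordS_eq /d; case: (ltngtP i j) => [lt_ij|lt_ji|->].
- rewrite adj_lt //; lia.
- rewrite adj_sym adj_lt //; lia.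
- rewrite adj_irrefl; lia.
Qed.

(** * Cyclic incidences and suns *)

Lemma is_sun_induced (G : sgraph) (k : nat) (v u : 'I_k -> G) :
  3 <= k -> injective v -> injective u -> (forall i j, v i != u j) ->
  (forall i, adj (v i) (v (ordS i))) ->
  (forall i j, adj (u i) (v j) = (j == i) || (j == ordS i)) ->
  (forall i j, ~~ adj (u i) (u j)) ->
  exists A : {set G}, is_sun k (induced A).
Proof.
move=> k3 v_inj u_inj vu adjv adjuv adju.
pose f (s : 'I_k + 'I_k) := match s with inl i => v i | inr i => u i end.
have f_inj : injective f.
  case=> i [] j /= => [/v_inj->|/eqP|/eqP|/u_inj->] //; first by rewrite (negPf (vu _ _)).
  by rewrite eq_sym (negPf (vu _ _)).
pose A := [set f s | s : 'I_k + 'I_k].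
have fA s : f s \in A by apply: imset_f.
pose g s : induced A := exist _ (f s) (fA s).
have g_inj : injective g by move=> s t /(congr1 val) /f_inj.
have g_bij : bijective g.
  by apply: inj_card_bij; rewrite // card_sig card_imset // cardE.
exists A; split=> //; exists (g \o inl), (g \o inr); split.
- by apply: (eq_bij g_bij); case.
- by move=> i; apply: adjv.
move=> i x; have [h gK hK] := g_bij; rewrite -(hK x).
rewrite /= !(inj_eq g_inj); case: (h x) => j.
  exact: adjuv.
exact: negPf (adju i j).
Qed.

(* A k-cycle submatrix of the closed neighbourhood matrix.  The families are
   k-periodic over nat, so that shifting the index is total. *)
Record cyclic_incidence (G : sgraph) (k : nat) (a z : nat -> G) : Prop := {
  cyc_a : forall i, a (i + k) = a i;
  cyc_z : forall i, z (i + k) = z i;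
  cyc_near : forall i j,
    near (z i) (a j) = (j == i %[mod k]) || (j == i.+1 %[mod k]) }.

Section Cyclic.
Variables (G : sgraph) (k : nat).
Implicit Types a z : nat -> G.
Hypothesis k3 : 3 <= k.

(** Rotation: arguments made at index 0 carry over to every index. *)
Lemma cyc_shift (s : nat) a z : cyclic_incidence k a z ->
  cyclic_incidence k (fun i => a (s + i)) (fun i => z (s + i)).
Proof.
case=> Ha Hz H; split=> [i|i|i j]; rewrite ?addnA //.
by rewrite H -addnS !eqn_modDl.
Qed.

(** Transposition of the matrix: among the z's, [a i.+1] is near exactly [z i] and [z i.+1], so the
    two families trade roles. *)
Lemma cyc_swap a z : cyclic_incidence k a z ->
  cyclic_incidence k z (fun i => a i.+1).
Proof.
case=> Ha Hz H; split=> [i|i|i j] //=; first by rewrite -addSn.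
rewrite near_sym H -/(1 + i) -/(1 + j) (eqn_modDl 1) orbC.
by rewrite eq_sym [in X in _ || X]eq_sym.
Qed.

Section Facts.
Variables (a z : nat -> G).
Hypothesis cyc : cyclic_incidence k a z.

(** The value j = k is allowed because walks going around the cycle pass through [a k], which is
    [a 0]. *)
Lemma cyc_nearE i j : i < k -> j <= k -> near (z i) (a j) =
  [|| j == i, j == i.+1, (i == 0) && (j == k) | (i.+1 == k) && (j == 0)].
Proof.
move=> lt_i le_j; rewrite (cyc_near cyc) (modn_small lt_i).
have [lt_j|ge_j] := ltnP j k; last first.
  have -> : j = k by lia.
  rewrite modnn; have [lt_i1|ge_i1] := ltnP i.+1 k.
    by rewrite modn_small //; lia.
  by have -> : i.+1 = k; [lia | rewrite modnn; lia].
rewrite modn_small //; have [lt_i1|ge_i1] := ltnP i.+1 k.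
  by rewrite modn_small //; lia.
by have -> : i.+1 = k; [lia | rewrite modnn; lia].
Qed.

Lemma cyc_near0 i : near (z i) (a i).
Proof. by rewrite (cyc_near cyc) eqxx. Qed.

Lemma cyc_near1 i : near (z i) (a i.+1).
Proof. by rewrite (cyc_near cyc) eqxx orbT. Qed.

Lemma cyc_wrap : a k = a 0 /\ z k = z 0.
Proof. by rewrite -[k]add0n (cyc_a cyc) (cyc_z cyc). Qed.

(** If [a i = a j], then [z i] is near [a j] and [z j] is near [a i]. For distinct i, j this forces
    j = i + 1 and i = j + 1 modulo k, impossible when k is at least 3. *)
Lemma cyc_inj_a i j : i < k -> j < k -> a i = a j -> i = j.
Proof.
move=> lt_i lt_j Eij; have le_j := ltnW lt_j.
have := cyc_near0 i; rewrite Eij cyc_nearE //.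
have := cyc_near0 j; rewrite -Eij cyc_nearE //; lia.
Qed.

End Facts.

Lemma cyc_inj_z a z i j : cyclic_incidence k a z ->
  i < k -> j < k -> z i = z j -> i = j.
Proof. by move/cyc_swap/cyc_inj_a; apply. Qed.

Hypothesis triG : triangulated G.

(** The edge from [z 0] to [a 1] is bypassed by the walk [z 0], [a k], [z (k - 1)], ..., [z 1],
    [a 1], so its ends have a common neighbour in the configuration. By the incidences this can only
    be [a 0] or [z 1]. *)
Lemma cyc_dichotomy0 a z : cyclic_incidence k a z ->
  adj (a 0) (a 1) || adj (z 0) (z 1).
Proof.
move=> cyc; have nE := cyc_nearE cyc; have [ak _] := cyc_wrap cyc.
have a01 : a 0 != a 1 by apply/eqP => /(cyc_inj_a cyc); lia.
have [Ez|z0a1] := eqVneq (z 0) (a 1).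
  by rewrite near_adj // -Ez near_sym cyc_near0.
pose W := [set v | [exists j : 'I_k, (v == a j) || (v == z j)]].
have aW j : j <= k -> a j \in W.
  rewrite leq_eqVlt inE => /orP[/eqP->|lt_j]; apply/existsP.
    by exists (Ordinal (ltnW (ltnW k3))); rewrite ak eqxx.
  by exists (Ordinal lt_j); rewrite eqxx.
have zW j : j < k -> z j \in W.
  by move=> lt_j; rewrite inE; apply/existsP; exists (Ordinal lt_j); rewrite eqxx orbT.
have z0_adj : adj (z 0) (a 1) by rewrite near_adj // cyc_near1.
have az i j : z i = a j -> i < k -> j <= k ->
    [|| j == i, j == i.+1, (i == 0) && (j == k) | (i.+1 == k) && (j == 0)].
  by move=> Eij lt_i le_j; rewrite -nE // Eij near_refl.
have injz i j : i < k -> j < k -> z i = z j -> i = j := cyc_inj_z cyc.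
have inja i : i <= k -> a i = a 1 -> i = 1.
  rewrite leq_eqVlt => /orP[/eqP->|lt_i /(cyc_inj_a cyc)]; last by apply; lia.
  by rewrite ak => E; case/eqP: a01.
have: connect (avoiding W (z 0) (a 1)) (z 0) (a 1).
  suff walk n : n < k -> connect (avoiding W (z 0) (a 1)) (z 0) (a (k - n)).
    by have := walk k.-1; rewrite (_ : k - k.-1 = 1); [apply; lia | lia].
  elim: n => [_|n IHn lt_n].
    rewrite subn0; apply: avoiding_step; rewrite ?zW ?aW ?ak //; try lia.
    - exact: cyc_near0.
    - by case=> _ E; case/eqP: a01.
    by case=> E; case/eqP: z0a1.
  have le_n : k - n <= k by lia.
  have lt_n1 : k - n.+1 < k by lia.
  have Sn : (k - n.+1).+1 = k - n by lia.
  apply: connect_trans (IHn _) _; first exact: ltnW.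
  apply: (@connect_trans _ _ (z (k - n.+1))).
    apply: avoiding_step; rewrite ?zW ?aW //.
    - by rewrite near_sym -Sn cyc_near1.
    - case=> /esym/az E1 /az E2.
      by have := E1 ltac:(lia) ltac:(lia); have := E2 ltac:(lia) ltac:(lia); lia.
    by case=> /inja E _; have := E ltac:(lia); lia.
  apply: avoiding_step; rewrite ?zW ?aW //; try lia.
  - exact: cyc_near0.
  - by case=> /injz E _; have := E ltac:(lia) ltac:(lia); lia.
  case=> /az E1 E2; case/eqP: z0a1; rewrite -E2; congr a.
  by have := E1 ltac:(lia) ltac:(lia); lia.
case/common_neighbour => // w /and3P[].
rewrite inE => /existsP[j]; have lt_j := ltn_ord j.
move=> /orP[]/eqP-> zw wa.
  have := adj_near zw; rewrite nE ?(ltnW (ltn_ord j)) //; last lia.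
  case/or4P=> [/eqP E|/eqP E|H|H]; [ |by rewrite E adj_irrefl in wa|lia|lia].
  by move: wa; rewrite E => ->.
have := adj_near wa; rewrite nE //; last lia.
case/or4P=> [/eqP E|/eqP E|H|H]; [by rewrite E zw orbT| |lia|lia].
by case: E zw => <-; rewrite adj_irrefl.
Qed.

(** Now the edge from [a 1] to [z 1] is bypassed, by [a 1], [a 0], [z (k - 1)], [a (k - 1)], ...,
    [a 2], [z 1]; the hypothesis supplies the first step. *)
Lemma cyc_step0 a z : cyclic_incidence k a z ->
  adj (a 0) (a 1) -> adj (a 1) (a 2).
Proof.
move=> cyc a01; have nE := cyc_nearE cyc; have [ak _] := cyc_wrap cyc.
have inja i j : a i = a j -> i < k -> j < k -> i = j.
  by move=> E lt_i lt_j; apply: (cyc_inj_a cyc).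
have az i j : z i = a j -> i < k -> j <= k ->
    [|| j == i, j == i.+1, (i == 0) && (j == k) | (i.+1 == k) && (j == 0)].
  by move=> Eij lt_i le_j; rewrite -nE // Eij near_refl.
have [Ez|z1a1] := eqVneq (z 1) (a 1).
  rewrite near_adj //; first by apply/eqP => /inja E; have := E ltac:(lia) ltac:(lia).
  by rewrite -Ez cyc_near1.
(* Since [z 0] is not among the listed z's, the only candidate left for a common neighbour of [a 1]
   and [z 1] is [a 2]. *)
pose W := [set v | [exists j : 'I_k, (v == a j) || (0 < j) && (v == z j)]].
have aW j : j < k -> a j \in W.
  by move=> lt_j; rewrite inE; apply/existsP; exists (Ordinal lt_j); rewrite eqxx.
have zW j : 0 < j < k -> z j \in W.
  move=> /andP[j0 lt_j]; rewrite inE; apply/existsP; exists (Ordinal lt_j) => /=.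
  by rewrite j0 eqxx orbT.
have a1z1 : adj (a 1) (z 1) by rewrite adj_sym near_adj // cyc_near0.
have: connect (avoiding W (a 1) (z 1)) (a 1) (z 1).
  have walk n : n.+1 < k -> connect (avoiding W (a 1) (z 1)) (a 1) (z (k - n.+1)).
    elim: n => [_|n IHn lt_n].
      apply: (@connect_trans _ _ (a 0)); apply: avoiding_step; rewrite ?zW ?aW //; try lia.
      - by rewrite near_sym adj_near.
      - case=> _ /esym/az E; have := E ltac:(lia) ltac:(lia); lia.
      - by case=> E; case/eqP: z1a1.
      - by rewrite near_sym -ak; have := cyc_near1 cyc (k - 1); rewrite subn1 prednK //; lia.
      - by case=> /inja E; have := E ltac:(lia) ltac:(lia).
      by case=> /esym/az E; have := E ltac:(lia) ltac:(lia); lia.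
    have Sn : (k - n.+2).+1 = k - n.+1 by lia.
    apply: connect_trans (IHn _) _; first exact: ltnW.
    apply: (@connect_trans _ _ (a (k - n.+1))).
      apply: avoiding_step; rewrite ?zW ?aW //; try lia.
      - exact: cyc_near0.
      - by case=> /az E; have := E ltac:(lia) ltac:(lia); lia.
      by case=> _ /inja E; have := E ltac:(lia) ltac:(lia); lia.
    apply: avoiding_step; rewrite ?zW ?aW //; try lia.
    - by rewrite near_sym -Sn cyc_near1.
    - by case=> /inja E; have := E ltac:(lia) ltac:(lia); lia.
    case=> /esym/az E1 E2; case/eqP: z1a1; rewrite -E2; congr z.
    by have := E1 ltac:(lia) ltac:(lia); lia.
  by have := walk (k - 2); rewrite (_ : k - (k - 2).+1 = 1); [apply; lia | lia].
case/common_neighbour => // w /and3P[].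
rewrite inE => /existsP[j]; have lt_j := ltn_ord j.
move=> /orP[/eqP->|/andP[j0 /eqP->]] aw wz.
  have := adj_near wz; rewrite near_sym nE ?(ltnW (ltn_ord j)) //; last lia.
  case/or4P=> [/eqP E|/eqP E|H|H]; [by rewrite E adj_irrefl in aw| |lia|lia].
  by rewrite -E.
have := adj_near aw; rewrite near_sym nE //; last lia.
case/or4P=> [/eqP E|/eqP E|H|H]; [ |lia|lia|lia].
by rewrite -E adj_irrefl in wz.
Qed.

(** A rim vertex is near itself and its two rim neighbours, three distinct a's, whereas [z 0] is
    near only two. *)
Lemma rim_disjoint0 a z : cyclic_incidence k a z ->
  (forall i, adj (a i) (a i.+1)) -> forall i, i < k -> a i != z 0.
Proof.
move=> cyc rim i lt_i; apply/eqP => Ei.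
have nE := cyc_nearE cyc; have [ak _] := cyc_wrap cyc.
have: near (z 0) (a i) by rewrite Ei near_refl.
rewrite nE; [ |lia|lia].
case/or4P=> [/eqP i0|/eqP i1|H|H]; [ | |lia|lia].
  have: near (z 0) (a k.-1).
    rewrite -Ei i0 -ak near_sym adj_near //.
    by have := rim k.-1; rewrite prednK //; lia.
  by rewrite nE; lia.
have: near (z 0) (a 2) by rewrite -Ei i1 adj_near.
by rewrite nE; lia.
Qed.

(** An edge from [z 0] to [z j] would be bypassed by [z 0], [a 1], ..., [a j], [z j]. A common
    neighbour would be some [a i] on this walk, but [z 0] forces i = 1 and [z j] forces i = j. *)
Lemma rim_independent0 a z : cyclic_incidence k a z ->
  (forall i, adj (a i) (a i.+1)) -> forall j, 1 < j < k -> ~~ adj (z 0) (z j).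
Proof.
move=> cyc rim j /andP[j1 lt_j]; apply/negP => zz.
have nE := cyc_nearE cyc; have az := rim_disjoint0 cyc rim.
pose W := [set v | [|| v == z 0, v == z j | [exists i : 'I_k, (0 < i <= j) && (v == a i)]]].
have z0W : z 0 \in W by rewrite inE eqxx.
have zjW : z j \in W by rewrite inE eqxx orbT.
have aW i : 0 < i <= j -> a i \in W.
  move=> /andP[i0 le_i]; have lt_i := leq_ltn_trans le_i lt_j.
  by rewrite inE; apply/or3P/Or33/existsP; exists (Ordinal lt_i); rewrite /= i0 le_i eqxx.
have: connect (avoiding W (z 0) (z j)) (z 0) (z j).
  have az0 i : i < k -> a i <> z 0 by move=> lt_i; apply/eqP/az.
  apply: (@connect_trans _ _ (a j)); last first.
    apply: avoiding_step; rewrite ?aW //; try lia.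
    - by rewrite near_sym cyc_near0.
    - by case=> E _; move: E; apply: az0.
    - by case=> _ E; move: zz; rewrite -E adj_irrefl.
  have walk i : i < j -> connect (avoiding W (z 0) (z j)) (z 0) (a i.+1).
    elim: i => [_|i IHi lt_i].
      apply: avoiding_step; rewrite ?aW //; try lia.
      - by rewrite cyc_near1.
      - case=> _ E; have: near (z j) (a 1) by rewrite E near_refl.
        by rewrite nE; lia.
      - by case=> _; apply: az0; lia.
    apply: connect_trans (IHi (ltnW lt_i)) _.
    apply: avoiding_step; rewrite ?aW //; try lia.
    - exact: adj_near.
    - by case=> E _; move: E; apply: az0; lia.
    - by case=> _; apply: az0; lia.
  by have := walk j.-1; rewrite prednK; [apply; lia | lia].
case/common_neighbour => // w /and3P[].
rewrite inE => /or3P[/eqP->|/eqP->|/existsP[i /andP[i_j /eqP->]]]; rewrite ?adj_irrefl //.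
move=> zi iz; have := adj_near iz; have := adj_near zi.
by have := ltn_ord i; rewrite [near (a i) _]near_sym => lt_i; rewrite !nE //; lia.
Qed.

Lemma rim_sun a z : cyclic_incidence k a z ->
  (forall i, adj (a i) (a i.+1)) -> exists A : {set G}, is_sun k (induced A).
Proof.
move=> cyc rim; have [ak _] := cyc_wrap cyc.
have rim' s i : adj (a (s + i)) (a (s + i.+1)) by rewrite addnS.
have disj i j : i < k -> j < k -> a i != z j.
  move=> lt_i lt_j; have az := rim_disjoint0 (cyc_shift j cyc) (rim' j).
  have [le_ji|lt_ij] := leqP j i.
    by have := az (i - j); rewrite addn0 subnKC //; apply; lia.
  have := az (i + k - j); rewrite addn0 subnKC; last lia.
  by rewrite (cyc_a cyc); apply; lia.
have indep_lt i j : i < j -> j < k -> ~~ adj (z i) (z j).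
  move=> lt_ij lt_j; have zz s := rim_independent0 (cyc_shift s cyc) (rim' s).
  (* Distance 1 is not covered by [rim_independent0]; counted forwards from j, however, i is then at
     distance k - 1, which exceeds 1. *)
  have [j_i|j_i] := eqVneq j i.+1.
    have := zz j k.-1; rewrite addn0 (_ : j + k.-1 = i + k) ?(cyc_z cyc) 1?adj_sym; last lia.
    by apply; lia.
  by have := zz i (j - i); rewrite addn0 subnKC ?(ltnW lt_ij) //; apply; lia.
have aS (i : 'I_k) : a (ordS i) = a i.+1.
  rewrite /=; have [/modn_small->//|le_k] := ltnP i.+1 k.
  have -> : i.+1 = k by have := ltn_ord i; lia.
  by rewrite modnn ak.
apply: (@is_sun_induced G k (fun i => a i) (fun i => z i)) => //.
- by move=> i j E; apply: val_inj; apply: (cyc_inj_a cyc) E.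
- by move=> i j E; apply: val_inj; apply: (cyc_inj_z cyc) E.
- by move=> i j; apply: disj.
- by move=> i; rewrite aS.
- move=> i j; transitivity (near (z i) (a j)).
    by rewrite /near eq_sym (negPf (disj _ _ _ _)).
  have := ltn_ord i; have := ltn_ord j.
  by rewrite (cyc_nearE cyc) ?(ltnW (ltn_ord j)) // ordS_eq -(val_eqE j i) /=; lia.
move=> i j; case: (ltngtP i j) => [lt_ij|lt_ji|->]; last by rewrite adj_irrefl.
  exact: indep_lt.
by rewrite adj_sym indep_lt.
Qed.

Lemma cyc_step a z i : cyclic_incidence k a z ->
  adj (a i) (a i.+1) -> adj (a i.+1) (a i.+2).
Proof.
move=> cyc; have := cyc_step0 (cyc_shift i cyc).
by rewrite addn0 addn1 addn2.
Qed.

Lemma cyc_rim a z : cyclic_incidence k a z ->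
  adj (a 0) (a 1) -> forall i, adj (a i) (a i.+1).
Proof. by move=> cyc a01; elim=> // i; apply: cyc_step cyc. Qed.

(** The dichotomy gives one of the families its first edge, [cyc_step] carries it all the way
    around, and that family becomes the rim of the sun. *)
Lemma cyclic_incidence_sun a z : cyclic_incidence k a z ->
  exists A : {set G}, is_sun k (induced A).
Proof.
move=> cyc; case/orP: (cyc_dichotomy0 cyc) => [a01|z01].
  exact: rim_sun cyc (cyc_rim cyc a01).
exact: rim_sun (cyc_swap cyc) (cyc_rim (cyc_swap cyc) z01).
Qed.

End Cyclic.

(** * Colourings *)

(** In a longest duplicate-free path within [A], a neighbour of the head lying off the path would
    prolong it. *)
Lemma maximal_path (T : finType) (e : rel T) (A : {set T}) (x0 : T) :
  symmetric e -> x0 \in A ->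
  exists x p, [/\ path e x p, uniq (x :: p), {subset x :: p <= A} &
    forall y, y \in A -> e x y -> y \in x :: p].
Proof.
move=> e_sym x0A.
pose Q n := [exists t : n.-tuple T,
  [&& uniq t, sorted e t, all (mem A) t & 0 < n]].
have exQ : exists n, Q n.
  by exists 1; apply/existsP; exists [tuple x0]; rewrite /= x0A.
have maxQ n : Q n -> n <= #|T|.
  case/existsP=> t /and4P[Ut _ _ _].
  by have := max_card (mem t); rewrite (card_uniqP Ut) size_tuple.
case: (ex_maxnP exQ maxQ) => m /existsP[t /and4P[Ut et tA m_gt0]] max_m.
case Dt: (tval t) Ut et tA => [|x p] Ut et /allP tA.
  by move: m_gt0; rewrite -(size_tuple t) Dt.
exists x, p; split=> // y yA exy; apply: contraT => np.
suff: Q m.+1 by move=> /max_m; rewrite ltnn.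
have sz : size (y :: x :: p) == m.+1 by rewrite /= -(size_tuple t) Dt.
apply/existsP; exists (Tuple sz); rewrite -[tval _]/(y :: x :: p) cons_uniq np Ut /=.
have et' : path e x p := et; have /= tA' : all (mem A) (x :: p) by apply/allP.
by rewrite e_sym exy et' yA tA'.
Qed.

(** * Two-colourings of neighbourhood traces *)

Section TwoColours.
Variable G : sgraph.
Implicit Types (T : {set G}) (c : G -> bool).

Definition two_coloured T c := forall z, 1 < #|nbhd z :&: T| ->
  exists u v, [/\ u \in nbhd z :&: T, v \in nbhd z :&: T & c u != c v].

(** The graph of two-element traces; [u != v] discards one-element traces, which have the form
    [[set u; u]]. *)
Definition trace_edge T : rel G := fun u v =>
  (u != v) && [exists z, nbhd z :&: T == [set u; v]].

Lemma trace_edge_sym T : symmetric (trace_edge T).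
Proof.
move=> u v; rewrite /trace_edge eq_sym; congr (_ && _).
by apply: eq_existsb => z; rewrite setUC.
Qed.

(** Take for [z i] a vertex whose trace is the i-th edge of the cycle. All [a j] lie in [T], so the
    trace decides exactly which of them are near [z i]. *)
Lemma trace_cycle_incidence T (s : seq G) :
  0 < size s -> uniq s -> cycle (trace_edge T) s ->
  exists a z : nat -> G, cyclic_incidence (size s) a z.
Proof.
case: s => // x p _; set s := x :: p; set k := size s => Us cyc_s.
pose a i := nth x s (i %% k).
pose z i := odflt x [pick w | nbhd w :&: T == [set a i; a i.+1]].
have mod_lt i : i %% k < k by rewrite ltn_mod.
have a_eq i j : (a i == a j) = (i == j %[mod k]) by rewrite nth_uniq.
have edge i : trace_edge T (a i) (a i.+1).
  have /(pathP x)/(_ (i %% k)) : path (trace_edge T) x (rcons p x) by [].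
  rewrite size_rcons => /(_ (mod_lt i)).
  rewrite -rcons_cons nth_rcons -/s -/k mod_lt nth_rcons.
  rewrite /a -(addn1 i) -modnDml addn1; have := mod_lt i.
  rewrite {2}/k /= ltnS leq_eqVlt => /orP[/eqP->|lt_i].
    by rewrite ltnn eqxx -[(size p).+1]/k modnn.
  by rewrite lt_i (@modn_small _.+1).
have zE i : nbhd (z i) :&: T = [set a i; a i.+1].
  rewrite /z; case: pickP => [w /eqP //|no].
  by case/andP: (edge i) => _ /existsP[w]; rewrite no.
have aT i : a i \in T.
  by have: a i \in nbhd (z i) :&: T; [rewrite zE set21 | case/setIP].
exists a, z; split=> [i|i|i j].
- by rewrite /a modnDr.
- by rewrite /z /a -addSn !modnDr.
have : (a j \in nbhd (z i) :&: T) = (a j \in [set a i; a i.+1]) by rewrite zE.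
by rewrite !inE aT andbT !a_eq.
Qed.

Hypothesis triG : triangulated G.
Hypothesis sun_free : ~ contains_odd_sun G.

Lemma no_odd_trace_cycle T (s : seq G) :
  2 < size s -> uniq s -> cycle (trace_edge T) s -> ~~ odd (size s).
Proof.
move=> s3 Us cyc_s; apply/negP => odd_s.
have [|a [z cyc]] := trace_cycle_incidence _ Us cyc_s; first exact: ltnW (ltnW _).
have [A sunA] := cyclic_incidence_sun s3 triG cyc.
by apply: sun_free; exists (size s), A.
Qed.

(* A longest path x :: p of two-element traces meets all traces {x, y}.  Were
   the colouring of T minus x not extendable to x, then x would be joined to
   the vertex p_j of colour opposite to p_0, and x, p_0, ..., p_j would be an
   odd cycle. *)
Lemma two_colouring T : exists c, two_coloured T c.
Proof.
have [n] := ubnP #|T|; elim: n T => // n IHn T; rewrite ltnS => le_T.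
have [->|[x0 x0T]] := set_0Vmem T.
  by exists xpredT => z; rewrite setI0 cards0.
have [x [p [path_p Up pT max_p]]] := maximal_path (@trace_edge_sym T) x0T.
have xT : x \in T by rewrite pT ?mem_head.
have [xNp _] := andP Up.
have [c col_c] : exists c, two_coloured (T :\ x) c.
  by apply: IHn; rewrite (cardsD1 x T) xT in le_T.
pose d := nth x (x :: p).
have edge_d i : i < size p -> trace_edge T (d i) (d i.+1).
  by move: i; apply/pathP.
(* The edge from p_j to p_(j+1) misses [x], so it remains a trace on [T :\ x] and [c] separates its
   ends. *)
have alt j : j < size p -> c (d j.+1) = c (d 1) (+) odd j.
  elim: j => [|j IHj] lt_j; first by rewrite addbF.
  have {IHj} := IHj (ltnW lt_j); have := edge_d j.+1 lt_j.
  case/andP=> neq_d /existsP[z /eqP zE].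
  have xNd i : i < size p -> d i.+1 != x.
    by move=> lt_i; apply: contraNneq xNp => <-; apply: mem_nth.
  have zEx : nbhd z :&: (T :\ x) = [set d j.+1; d j.+2].
    rewrite setIDA zE; apply/setDidPl; rewrite disjoint_sym disjoints1 !inE.
    by rewrite ![x == _]eq_sym !negb_or !xNd // ltnW.
  have [|u [v []]] := col_c z; first by rewrite zEx cards2 neq_d.
  rewrite zEx !inE /= => /orP[]/eqP-> /orP[]/eqP->; rewrite ?eqxx //.
    by case: (c (d j.+1)) (c (d j.+2)) (c (d 1)) (odd j) => [] [] [] [].
  by case: (c (d j.+1)) (c (d j.+2)) (c (d 1)) (odd j) => [] [] [] [].
pose c' y := if y == x then ~~ c (d 1) else c y.
exists c' => z; set X := nbhd z :&: T => X2.
have [/exists_inP[u uX /exists_inP[v vX cuv]]|] :=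
  boolP [exists u in X, [exists v in X, c' u != c' v]]; first by exists u, v.
rewrite negb_exists_in => /forall_inP mono; exfalso.
have {}mono u v : u \in X -> v \in X -> c' u = c' v.
  move=> uX vX; have := mono u uX; rewrite negb_exists_in => /forall_inP/(_ v vX).
  by rewrite negbK => /eqP.
have XD : nbhd z :&: (T :\ x) = X :\ x by rewrite setIDA.
(* Two elements besides [x] would already receive both colours from [c]; hence a monochromatic trace
   has the form {x, b}. *)
have Xx1 : #|X :\ x| <= 1.
  rewrite leqNgt -XD; apply/negP => /col_c[u [v []]].
  rewrite XD !inE => /andP[ux uX] /andP[vx vX] /eqP[].
  by have := mono u v; rewrite !inE uX vX /c' (negPf ux) (negPf vx); apply.
have xX : x \in X.
  by apply: contraLR Xx1 => xX; rewrite -ltnNge (cardsD1 x) (negPf xX) in X2 *.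
have /cards1P[b Db] : #|X :\ x| == 1.
  by move: X2; rewrite eqn_leq Xx1 (cardsD1 x X) xX.
have DX : X = [set x; b] by rewrite -Db setD1K.
have [bx bX] : b != x /\ b \in X by apply/setD1P; rewrite Db set11.
have xb : trace_edge T x b by rewrite /trace_edge eq_sym bx; apply/existsP; exists z; apply/eqP.
have bp : b \in p.
  have := max_p b _ xb; rewrite inE (negPf bx) /=; apply.
  by case/setIP: bX.
pose j := index b p.
have lt_j : j < size p by rewrite index_mem.
have dj : d j.+1 = b by rewrite /d /= nth_index.
have odd_j : odd j.
  have := mono x b xX bX; rewrite /c' eqxx (negPf bx) -dj (alt j lt_j).
  by case: (c (d 1)) (odd j) => [] [].
(* The vertices x, p_0, ..., p_j = b, closed up by the trace {x, b}; their number j + 2 is odd. *)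
pose s := take j.+2 (x :: p).
have size_s : size s = j.+2 by rewrite size_takel.
have s3 : 2 < size s by rewrite size_s !ltnS; case: (j) odd_j.
have Us : uniq s by apply: take_uniq.
have path_s : path (trace_edge T) x (take j.+1 p).
  by move: path_p; rewrite -{1}(cat_take_drop j.+1 p) cat_path => /andP[].
have cyc_s : cycle (trace_edge T) s.
  rewrite /s /= rcons_path path_s (last_nth x) size_takel //= nth_take //.
  by rewrite -[nth x p j]/(d j.+1) dj trace_edge_sym.
by have := no_odd_trace_cycle s3 Us cyc_s; rewrite size_s /= odd_j.
Qed.

End TwoColours.

Lemma card_imset_split (I J : finType) (h : I -> J) (P : {set J}) (E : {set I}) :
  #|h @: E| = #|h @: (E :&: h @^-1: P)| + #|h @: (E :\: h @^-1: P)|.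
Proof.
rewrite -[in LHS](setID E (h @^-1: P)) imsetU cardsU.
set A := h @: (E :&: _); set B := h @: _.
suff -> : A :&: B = set0 by rewrite cards0 subn0.
apply/setP=> y; rewrite !inE.
apply/negP => /andP[/imsetP[i + ->] /imsetP[j + Eij]].
by rewrite !inE -Eij => /andP[_ ->].
Qed.

(** * Rainbow colourings of families with repetition *)

Section Colouring.
Variable G : sgraph.
Hypothesis triG : triangulated G.
Hypothesis sun_free : ~ contains_odd_sun G.

Section Family.
Variables (I : finType) (f : I -> G).

(** Indices are coloured rather than vertices, so that a vertex may occur several times. *)
Definition members (y : G) : {set I} := [set i | f i \in nbhd y].

(** Vertices occurring once in [S] are coloured by [two_colouring]. A repeated vertex has one chosen
    copy coloured true and the others false, so every neighbourhood containing it sees both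
    colours. *)
Lemma two_colouring_family (S : {set I}) : exists b : I -> bool,
  forall z, 1 < #|members z :&: S| ->
  exists i j, [/\ i \in members z :&: S, j \in members z :&: S & b i != b j].
Proof.
pose fibre v := [set i in S | f i == v].
pose T := [set v | #|fibre v| == 1].
have [c col_c] := two_colouring triG sun_free T.
pose b i := if f i \in T then c (f i) else Some i == [pick j in fibre (f i)].
exists b => z z2.
have [/exists_inP[i /setIP[iz iS] iT]|] := boolP [exists i in members z :&: S, f i \notin T].
  have i_fib : i \in fibre (f i) by rewrite inE iS eqxx.
  have : 1 < #|fibre (f i)|.
    by move: iT; rewrite inE (cardsD1 i) i_fib; case: #|_|.
  have [r r_fib Dr] : exists2 r, r \in fibre (f i) & [pick j in fibre (f i)] = Some r.
    by case: pickP => [r|/(_ i)]; [exists r | rewrite i_fib].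
  rewrite (cardsD1 r) r_fib => /card_gt0P[s /setD1P[s_r]].
  move: r_fib; rewrite !inE => /andP[rS /eqP Er] /andP[sS /eqP Es].
  rewrite !inE in iz; exists r, s; split; rewrite ?inE ?Er ?Es ?rS ?sS ?iz //.
  by rewrite /b Er Es (negPf iT) Dr eqxx (inj_eq Some_inj) (negPf s_r).
rewrite negb_exists_in => /forall_inP allT.
have {}allT i : i \in members z :&: S -> f i \in T.
  by move=> /allT; rewrite negbK.
have f_inj : {in members z :&: S &, injective f}.
  move=> i j iz jz Eij; apply/eqP; have := allT i iz; rewrite inE => /cards1P[r Dr].
  have : i \in fibre (f i) by rewrite inE eqxx; case/setIP: iz => _ ->.
  have : j \in fibre (f i) by rewrite inE Eij eqxx; case/setIP: jz => _ ->.
  by rewrite Dr !inE => /eqP-> /eqP->.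
have [|u [v [uz vz cuv]]] := col_c z.
  rewrite -(card_in_imset f_inj) in z2; apply: leq_trans z2 (subset_leq_card _).
  apply/subsetP => _ /imsetP[i iz ->]; rewrite inE allT // andbT.
  by case/setIP: iz; rewrite inE.
have lift u' : u' \in nbhd z :&: T -> exists2 i, i \in members z :&: S & u' = f i.
  case/setIP => uz'; rewrite inE => /cards1P[i Di].
  have : i \in fibre u' by rewrite Di set11.
  by rewrite inE => /andP[iS /eqP Ei]; exists i; rewrite // !inE Ei in uz' *; rewrite uz' iS.
have [[i iz Du] [j jz Dv]] := (lift u uz, lift v vz).
by exists i, j; split; rewrite // /b !allT // -Du -Dv.
Qed.

(* Recolouring two classes by [two_colouring_family] shows that a colouring
   seeing the most colours in total is injective on every neighbourhood. *)
Lemma rainbow_colouring (k : nat) : (forall y, #|members y| <= k.+1) ->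
  exists c : I -> 'I_k.+1, forall y, {in members y &, injective c}.
Proof.
move=> le_k.
pose Phi (c : {ffun I -> 'I_k.+1}) := \sum_y #|c @: members y|.
have [c _ max_c] := @arg_maxnP _ [ffun=> ord0] xpredT Phi isT.
exists c => y i j iy jy Eij; apply/eqP; apply: contraT => nij.
set p := c i.
(* The members of [y] number at most k + 1 and two of them share a colour, so some colour is
   missing. *)
have [q qNy] : exists q, q \notin c @: members y.
  apply/existsP; rewrite -negb_forall; apply/negP => /forallP all_q.
  have: c @: members y = setT by apply/setP => q; rewrite all_q inE.
  move/(congr1 (fun A : {set _} => #|A|)); rewrite cardsT card_ord => Ek.
  have := leq_imset_card c (members y :\ j).
  have -> : c @: (members y :\ j) = c @: members y.
    apply/eqP; rewrite eqEsubset imsetS ?subD1set //=; apply/subsetP => _ /imsetP[l ly ->].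
    have [->|lj] := eqVneq l j; last by apply: imset_f; apply/setD1P.
    by rewrite -Eij; apply: imset_f; apply/setD1P.
  by have := le_k y; rewrite Ek (cardsD1 j) jy; lia.
have pq : p != q by apply: contraNneq qNy => <-; apply: imset_f.
pose P := [set p; q]; pose S := c @^-1: P.
have [b col_b] := two_colouring_family S.
pose c' := [ffun l => if l \in S then if b l then p else q else c l].
have c'S : c' @^-1: P = S.
  apply/setP => l; rewrite inE ffunE; have [lS|lS] := ifPn; last by move: lS; rewrite inE => /negPf.
  by case: (b l); rewrite !inE eqxx ?orbT.
have c'D z : c' @: (members z :\: S) = c @: (members z :\: S).
  by apply: eq_in_imset => l /setDP[_ lS]; rewrite ffunE (negPf lS).
have two z : 1 < #|members z :&: S| -> #|c' @: (members z :&: S)| = 2.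
  case/col_b=> l [m [lz mz blm]].
  have -> : c' @: (members z :&: S) = P.
    apply/eqP; rewrite eqEsubset; apply/andP; split.
      by apply/subsetP => _ /imsetP[r /setIP[_ rS] ->]; rewrite -c'S inE in rS.
    have [[_ lS] [_ mS]] := (setIP lz, setIP mz).
    have [cl cm] := (imset_f c' lz, imset_f c' mz); move: cl cm; rewrite !ffunE lS mS.
    by case: (b l) (b m) blm => [] [] // _ h1 h2; apply/subsetP => r; rewrite !inE => /orP[]/eqP->.
  by rewrite cards2 pq.
have le2 z : #|c @: (members z :&: S)| <= 2.
  have <- : #|P| = 2 by rewrite cards2 pq.
  by apply/subset_leq_card/subsetP => _ /imsetP[r /setIP[_ rS] ->]; rewrite inE in rS.
(* Colours outside [P] are unchanged. Inside [P], two or more members now show both colours, and a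
   single member shows one as before. The equality case gives strictness at [y]. *)
have le_c z : #|c @: members z| <= #|c' @: members z| ?= iff
    (#|c @: (members z :&: S)| == #|c' @: (members z :&: S)|).
  rewrite (card_imset_split c P) (card_imset_split c' P) c'S c'D -/S.
  split; last by rewrite eqn_add2r.
  rewrite leq_add2r; case: (ltnP 1 #|members z :&: S|) => [/two-> //|le1].
  apply: leq_trans (leq_imset_card _ _) _.
  have [->|[l lz]] := set_0Vmem (members z :&: S); first by rewrite cards0.
  by apply: leq_trans le1 _; rewrite card_gt0; apply/set0Pn; exists (c' l); apply: imset_f.
suff: Phi c < Phi c' by rewrite ltnNge; have /= -> := max_c c' isT.
have sy : #|c @: (members y :&: S)| < #|c' @: (members y :&: S)|.
  have [iS jS] : i \in S /\ j \in S by rewrite !inE -Eij -/p eqxx.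
  rewrite two; last by apply/card_gt1P; exists i, j; split=> //; apply/setIP.
  have -> : c @: (members y :&: S) = [set p]; last by rewrite cards1.
  apply/setP => r; rewrite inE; apply/imsetP/eqP => [[l /setIP[ly lS] ->]|->].
    move: lS; rewrite !inE => /orP[]/eqP // cl.
    by case/negP: qNy; rewrite -cl; apply: imset_f.
  by exists i => //; apply/setIP.
rewrite /Phi (bigD1 y) //= [ltnRHS](bigD1 y) //= -addSn leq_add //.
  by rewrite (ltn_leqif (le_c y)) (ltn_eqF sy).
by apply: leq_sum => z _; rewrite (le_c z).
Qed.

End Family.

(** * Packing and domination *)

Definition packing (M : {set G}) := [forall y, #|M :&: nbhd y| <= 1].

Lemma packingP (M : {set G}) :
  reflect (forall y u v, u \in M -> v \in M -> u \in nbhd y -> v \in nbhd y -> u = v)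
    (packing M).
Proof.
apply: (iffP forallP) => [pM y u v uM vM uy vy|pM y].
  by have /card_le1_eqP := pM y; apply; apply/setIP.
apply/card_le1_eqP => u v /setIP[uM uy] /setIP[vM vy]; exact: (pM y).
Qed.

(* If every y admits a maximum packing F_y of E that avoids the neighbours of
   y, the disjoint union of the F_y meets each neighbourhood at most #|G| - 1
   times, so a rainbow colouring with #|G| - 1 colours has a class exceeding
   the maximum. *)
Lemma packing_unavoidable (E : {set G}) (m : nat) (x0 : G) : 0 < m ->
  (forall M : {set G}, M \subset E -> packing M -> #|M| <= m) ->
  exists y, forall M : {set G}, M \subset E :\: nbhd y -> packing M -> #|M| < m.
Proof.
move=> m_gt0 max_m.
pose ok y (M : {set G}) := [&& M \subset E :\: nbhd y, packing M & m <= #|M|].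
have [/existsP[y /existsP Ny]|] := boolP [exists y, ~~ [exists M : {set G}, ok y M]].
  exists y => M ME pM; rewrite ltnNge; apply/negP => le_m; case: Ny.
  by exists M; apply/and3P.
rewrite negb_exists => /forallP avoid; exfalso.
pose F y := odflt set0 [pick M : {set G} | ok y M].
have okF y : ok y (F y).
  rewrite /F; case: pickP => [//|no]; have := avoid y; rewrite negbK => /existsP[M].
  by rewrite no.
have FP y : [/\ F y \subset E :\: nbhd y, packing (F y) & m <= #|F y|].
  exact/and3P/okF.
pose I := {w : G * G | w.2 \in F w.1}.
pose f (i : I) := (val i).2.
have card_I : #|G| * m <= #|{: I}|.
  have -> : #|{: I}| = \sum_y \sum_(v in F y) 1.
    by rewrite pair_big_dep sum1_card card_sig; apply: eq_card.
  by rewrite -sum_nat_const; apply: leq_sum => y _; rewrite sum1_card; case: (FP y).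
have G_gt0 : 0 < #|G|.
  by apply/card_gt0P; exists x0.
(* The neighbourhood of [y] meets each packing [F x] at most once and [F y] not at all. *)
have deg y : #|members f y| <= #|G|.-1.
  rewrite -(cardsC1 y).
  have h_inj : {in members f y &, injective (fun i : I => (val i).1)}.
    move=> [[x v] /= vF] [[x' v'] /= vF'] /=; rewrite ![in _ \in members _ _]inE /f /= => vy vy' E1.
    apply: val_inj => /=; rewrite -E1 in vF' *; congr pair.
    by have [_ /packingP pF _] := FP x; apply: (pF y).
  rewrite -(card_in_imset h_inj); apply/subset_leq_card/subsetP => _ /imsetP[i iy ->].
  rewrite !inE; apply/eqP => Ei; have := valP i; rewrite Ei => viF.
  have [/subsetP/(_ _ viF)] := FP y; rewrite inE => /andP[/negP[]].
  by move: iy; rewrite inE.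
(* With a single vertex the degree bound is 0, yet every index is a member at its own vertex; so the
   union would be empty. *)
case Dk: #|G|.-1 deg => [|k] deg.
  have card0 : #|{: I}| = 0.
    apply/eqP; rewrite -leqn0 leqNgt; apply/negP => /card_gt0P[i _].
    by have := deg (f i); rewrite leqNgt => /card_gt0P[]; exists i; rewrite !inE near_refl.
  by move: card_I; rewrite card0 leqNgt muln_gt0 G_gt0 m_gt0.
have [c c_inj] := rainbow_colouring deg.
(* A colour class maps injectively to a packing in [E]: copies of one vertex are members of its
   neighbourhood and so differ in colour. *)
have class_le q : #|[set i | c i == q]| <= m.
  have f_inj : {in [set i | c i == q] &, injective f}.
    move=> i j; rewrite !inE => /eqP ci /eqP cj Eij.
    by apply: (c_inj (f i)); rewrite ?ci ?cj // !inE ?Eij near_refl.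
  rewrite -(card_in_imset f_inj); apply: max_m.
    apply/subsetP => _ /imsetP[i _ ->]; have [/subsetP/(_ _ (valP i))] := FP (val i).1.
    by case/setDP.
  apply/packingP => y _ _ /imsetP[i + ->] /imsetP[j + ->]; rewrite !inE => /eqP ci /eqP cj iy jy.
  by congr f; apply: (c_inj y); rewrite ?inE // ci cj.
have : #|{: I}| <= k.+1 * m.
  rewrite -sum1_card (partition_big c xpredT) //=.
  rewrite -[X in X * m](card_ord k.+1) -sum_nat_const.
  apply: leq_sum => q _; rewrite sum1_card; apply: leq_trans (class_le q).
  by apply/eq_leq/eq_card => i; rewrite !inE.
by rewrite leqNgt (leq_trans _ card_I) // ltn_pmul2r // -Dk prednK.
Qed.

(** Induction on [E]: for a maximum packing [M], [packing_unavoidable] gives a [y] whose removal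
    with its neighbours lowers the maximum. A dominating set for the rest is then smaller than [M],
    leaving room for [y]. *)
Lemma packing_dominating (E : {set G}) : exists D M : {set G},
  [/\ M \subset E, packing M, #|D| <= #|M| &
      forall x, x \in E -> exists2 d, d \in D & x \in nbhd d].
Proof.
have [n] := ubnP #|E|; elim: n E => // n IHn E; rewrite ltnS => le_E.
pose ok (M : {set G}) := (M \subset E) && packing M.
have ok0 : ok set0.
  by rewrite /ok sub0set; apply/packingP => y u v; rewrite inE.
case: (arg_maxnP (fun M : {set G} => #|M|) ok0) => M /andP[ME pM] max_M.
have [E0|[x xE]] := set_0Vmem E.
  by exists set0, set0; rewrite cards0 E0 sub0set; case/andP: ok0 => _ ->; split=> // x; rewrite inE.
have M_gt0 : 0 < #|M|.
  apply: leq_trans (max_M [set x] _); first by rewrite cards1.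
  rewrite /ok sub1set xE; apply/packingP => y u v.
  by rewrite !inE => /eqP-> /eqP->.
have [y max_y] : exists y, forall M' : {set G}, M' \subset E :\: nbhd y -> packing M' -> #|M'| < #|M|.
  by apply: (packing_unavoidable x) => // M' M'E pM'; apply: max_M; apply/andP.
have ltE : #|E :\: nbhd y| < #|E|.
  apply: proper_card; rewrite properEneq subsetDl andbT; apply: contraTneq M_gt0 => EE.
  by have := max_y M; rewrite EE ltnn => /(_ ME pM).
have [D [M' [M'E pM' le_DM' domD]]] := IHn _ (leq_trans ltE le_E).
exists (y |: D), M; split=> //.
  apply: leq_trans (max_y _ M'E pM'); rewrite cardsU1; apply: leq_trans (leq_add (leq_b1 _) le_DM') _.
  by [].
move=> v vE; have [vy|vy] := boolP (v \in nbhd y); first by exists y; rewrite ?setU11.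
have [|d dD vd] := domD v; first by apply/setDP.
by exists d; rewrite // setU1r.
Qed.

End Colouring.

(** * Stars *)

Section Stars.
Variable G : sgraph.
Implicit Types (S : presubgraph G) (c x y : G) (D M : {set G}).

Lemma star_sub_nbhd S : star_subgraph S -> exists c, S.1 \subset nbhd c.
Proof.
case/andP=> /forall_inP subS /andP[_ /existsP[c /forallP starc]].
exists (val c); apply/subsetP => x xS; rewrite inE.
pose x' : subgraph_graph S := exist _ x xS.
have [->|nxc] := eqVneq x (val c); first exact: near_refl.
have /implyP/(_ nxc)/andP[_ /subS] := starc x'.
case/exists_inP=> u uS /exists_inP[v vS /andP[uv /eqP Euv]].
have: x \in [set u; v] by rewrite -Euv set22.
have: val c \in [set u; v] by rewrite -Euv set21.
rewrite !inE => /orP[]/eqP Dc /orP[]/eqP Dx; move: nxc; rewrite Dc Dx ?eqxx // => _.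
  exact: adj_near.
by rewrite near_sym adj_near.
Qed.

Definition full_star c : presubgraph G :=
  (nbhd c, [set [set c; y] | y in nbhd c :\ c]).

Lemma full_star_subgraph c : star_subgraph (full_star c).
Proof.
have cc : c \in (full_star c).1 by rewrite inE near_refl.
pose c' : subgraph_graph (full_star c) := exist _ c cc.
have adj_c (u : subgraph_graph (full_star c)) : u != c' -> adj c' u.
  move=> nuc; rewrite /= /subgraph_adj eq_sym nuc /=; apply: imset_f.
  by rewrite in_setD1 (valP u) andbT.
have adj_or (u v : subgraph_graph (full_star c)) : adj u v -> u = c' \/ v = c'.
  case/andP=> _ /imsetP[y _ Euv]; have: c \in [set val u; val v] by rewrite Euv set21.
  by rewrite !inE => /orP[]/eqP Ec; [left | right]; apply: val_inj.
apply/andP; split.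
  apply/forall_inP => _ /imsetP[y /setD1P[nyc yc] ->].
  apply/exists_inP; exists c => //; apply/exists_inP; exists y => //.
  by rewrite eqxx andbT near_adj 1?eq_sym //; rewrite inE in yc.
apply/andP; split; last first.
  by apply/existsP; exists c'; apply/forallP => u; apply/implyP/adj_c.
apply/andP; split.
  apply/andP; split; first by apply/card_gt0P; exists c'.
  have conn_c u : connect (@adj (subgraph_graph (full_star c))) c' u.
    by have [->//|/adj_c/connect1] := eqVneq u c'.
  apply/forallP => u; apply/forallP => v; apply: connect_trans (conn_c v).
  have [->//|nuc] := eqVneq u c'.
  by rewrite connect1 // adj_sym adj_c.
apply/forallP => k; apply/forallP => t; apply/implyP => /andP[k3 Ut].
apply/negP => cyc_t.
rewrite -(size_tuple t) in k3; case: (tval t) Ut cyc_t k3 => [|u [|v [|w s]]] // Ut.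
case/and3P=> /adj_or uv /adj_or vw ws _.
(* Let r follow w on the cycle, with r = u for a triangle. All edges contain the centre, so uv and
   vw force v to be the centre, and then wr misses it. *)
have {ws} : exists2 r, adj w r & r != v.
  case: s Ut ws => [|r s] /=; rewrite !inE !negb_or.
    by rewrite !andbT => /andP[/andP[uv' _] _] wu; exists u.
  by move=> /and4P[_ /and3P[_ vr _] _ _] /andP[wr _]; exists r; rewrite // eq_sym.
case=> r /adj_or wr rv; move: Ut rv; rewrite /= !inE !negb_or.
move=> /and4P[/and3P[uv' uw' _] /andP[vw' _] _ _] /eqP rv.
case: uv => Eu; case: vw => Ev.
- by rewrite Eu Ev eqxx in uv'.
- by rewrite Eu Ev eqxx in uw'.
- by case: wr => Ew; [rewrite Ew Eu eqxx in vw' | rewrite Ew Eu in rv].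
by rewrite Eu Ev eqxx in vw'.
Qed.

Definition dominating D := forall x, exists2 d, d \in D & x \in nbhd d.

Lemma S_independentE M : S_independent M = packing M.
Proof.
apply/forall_inP/packingP => [indM y u v uM vM uy vy|pM x xM].
  apply/eqP; have /forall_inP/(_ v vM)/implyP := indM u uM.
  case: eqVneq => // nuv /(_ isT)/negP[]; apply/existsP; exists (full_star y).
  by rewrite full_star_subgraph uy.
apply/forall_inP => y yM; apply/implyP; apply: contraNN => /existsP[S /and3P[starS xS yS]].
have [c /subsetP Sc] := star_sub_nbhd starS.
by apply/eqP; apply: (pM c); rewrite ?Sc.
Qed.

Lemma theta_S_le D : dominating D -> theta_S G <= #|D|.
Proof.
move=> domD; rewrite /theta_S; case: arg_minnP => [|C _ minC]; first exact: S_cover_all.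
apply: leq_trans (minC (full_star @: D) _) (leq_imset_card _ _).
apply/andP; split.
  by apply/forall_inP => _ /imsetP[d _ ->]; apply: full_star_subgraph.
apply/forallP => x; have [d dD xd] := domD x.
by apply/exists_inP; exists (full_star d); rewrite // imset_f.
Qed.

Lemma theta_S_dominating : exists2 D : {set G}, dominating D & #|D| <= theta_S G.
Proof.
rewrite /theta_S; case: arg_minnP => [|C /andP[/forall_inP starC /forallP covC] _].
  exact: S_cover_all.
have [G0|[x0 _]] := set_0Vmem [set: G].
  by exists set0; [move=> x; have := in_setT x; rewrite G0 inE | rewrite cards0].
pose centre S := odflt x0 [pick c | S.1 \subset nbhd c].
have centreP S : star_subgraph S -> S.1 \subset nbhd (centre S).
  by rewrite /centre => /star_sub_nbhd[c Sc]; case: pickP => [//|/(_ c)]; rewrite Sc.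
exists (centre @: C); last exact: leq_imset_card.
move=> x; have /exists_inP[S SC xS] := covC x; exists (centre S); first exact: imset_f.
exact: (subsetP (centreP S (starC S SC))).
Qed.

Lemma alpha_S_ge M : packing M -> #|M| <= alpha_S G.
Proof. by rewrite -S_independentE => indM; apply: leq_bigmax_cond. Qed.

Lemma alpha_S_packing : exists2 M : {set G}, packing M & alpha_S G = #|M|.
Proof.
have [|M indM E] := @eq_bigmax_cond _ (@S_independent G) (fun M => #|M|).
  apply/card_gt0P; exists set0; rewrite -[_ \in _]/(S_independent set0) S_independentE.
  by apply/packingP => y u v; rewrite inE.
by exists M; [rewrite -S_independentE; exact: indM | exact: E].
Qed.

(** Weak duality: one vertex dominates at most one member of a packing. *)
Lemma alpha_S_le_theta_S : alpha_S G <= theta_S G.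
Proof.
have [M /packingP pM ->] := alpha_S_packing.
have [D domD le_D] := theta_S_dominating; apply: leq_trans le_D.
pose g x := odflt x [pick d in D | x \in nbhd d].
have gP x : g x \in D /\ x \in nbhd (g x).
  rewrite /g; case: pickP => [d /andP[]//|no]; have [d dD xd] := domD x.
  by have := no d; rewrite dD xd.
have g_inj : {in M &, injective g}.
  by move=> x y xM yM Exy; apply: (pM (g x)) => //; [case: (gP x) | rewrite Exy; case: (gP y)].
rewrite -(card_in_imset g_inj); apply/subset_leq_card/subsetP => _ /imsetP[x _ ->].
by case: (gP x).
Qed.

Lemma alpha_S_theta_S : triangulated G -> ~ contains_odd_sun G ->
  alpha_S G = theta_S G.
Proof.
move=> triG sun_free; apply/eqP; rewrite eqn_leq alpha_S_le_theta_S /=.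
have [D [M [_ pM le_DM domD]]] := packing_dominating triG sun_free setT.
apply: leq_trans (alpha_S_ge pM); apply: leq_trans le_DM; apply: theta_S_le => x.
exact: domD.
Qed.

End Stars.

(** * Counting in odd suns, and induced subgraphs *)

Lemma sum_card_nbhd (G : sgraph) (M V : {set G}) :
  \sum_(x in M) #|nbhd x :&: V| = \sum_(y in V) #|M :&: nbhd y|.
Proof.
have cardE (X Y : {set G}) : #|X :&: Y| = \sum_(y in X) (y \in Y).
  by rewrite -sum1_card big_mkcond [RHS]big_mkcond; apply: eq_bigr => y _; rewrite inE; case: (y \in X).
under eq_bigr do rewrite setIC cardE.
rewrite exchange_big /=; apply: eq_bigr => y _; rewrite cardE.
by apply: eq_bigr => x _; rewrite !inE near_sym.
Qed.

Lemma odd_sun_gap (H : sgraph) (k : nat) :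
  odd k -> is_sun k H -> alpha_S H < theta_S H.
Proof.
move=> odd_k [k3 [v [u [vu_bij adjv adju]]]].
have vu_inj := bij_inj vu_bij.
have v_inj : injective v by move=> i j E; case: (vu_inj (inl i) (inl j) E).
have u_inj : injective u by move=> i j E; case: (vu_inj (inr i) (inr j) E).
have vu i j : v i <> u j by move=> E; have := vu_inj (inl i) (inr j) E.
have onto x : exists i, x = v i \/ x = u i.
  by have [h _ hK] := vu_bij; rewrite -(hK x); case: (h x) => i; exists i; [left | right].
have [M pM ->] := alpha_S_packing H.
have [D domD le_D] := theta_S_dominating H.
have card_range (w : 'I_k -> H) : injective w -> #|w @: setT| = k.
  by move=> w_inj; rewrite card_imset // cardsT card_ord.
(* The neighbourhoods of [v i] and of [u i] both contain [v i] and [v (ordS i)], while each rim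
   vertex is near at most one element of [M]. *)
have M2 : #|M| * 2 <= k.
  rewrite -[X in _ <= X](card_range v v_inj) -sum_nat_const.
  apply: (@leq_trans (\sum_(x in M) #|nbhd x :&: v @: setT|)).
    apply: leq_sum => x _; have [i xi] := onto x; apply/card_gt1P.
    exists (v i), (v (ordS i)); rewrite !inE !imset_f ?inE // !andbT adj_neq //.
    by case: xi => ->; rewrite ?near_refl /near ?adjv ?adju ?eqxx ?orbT.
  by rewrite sum_card_nbhd -sum1_card; apply: leq_sum => y _; exact: (forallP pM y).
(* Each [u i] has to be dominated; [v j] is near only [u j] and its predecessor, and [u j] is near
   no other [u i]. *)
have D2 : k <= #|D| * 2.
  rewrite -[X in X <= _](card_range u u_inj) -sum_nat_const.
  apply: (@leq_trans (\sum_(x in D) #|nbhd x :&: u @: setT|)).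
    rewrite sum_card_nbhd -sum1_card; apply: leq_sum => y _.
    have [d dD yd] := domD y; apply/card_gt0P; exists d.
    by rewrite !inE near_sym dD; rewrite inE in yd.
  apply: leq_sum => d _; have [j [->|->]] := onto d.
    apply: (@leq_trans #|[set u j; u (ord_pred j)]|); last by rewrite cards2; case: (_ == _).
    apply/subset_leq_card/subsetP => y /setIP[yd /imsetP[i _ Ey]].
    move: yd; rewrite Ey !inE near_sym /near adju !(inj_eq v_inj) (inj_eq u_inj).
    case/or3P => [/eqP/esym/vu //|/eqP->|/eqP->]; rewrite ?eqxx // ordSK eqxx orbT //.
  apply: (@leq_trans #|[set u j]|); last by rewrite cards1.
  apply/subset_leq_card/subsetP => y /setIP[yd /imsetP[i _ Ey]].
  move: yd; rewrite Ey !inE /near adju => /or3P[/eqP->|/eqP/esym/vu|/eqP/esym/vu] //.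
apply: leq_trans le_D; rewrite ltnNge; apply/negP => le_DM.
have : #|M| * 2 = k by apply/eqP; rewrite eqn_leq M2 (leq_trans D2) // leq_mul2r.
by move=> Ek; move: odd_k; rewrite -Ek oddM andbF.
Qed.

Lemma triangulated_induced (G : sgraph) (A : {set G}) :
  triangulated G -> triangulated (induced A).
Proof.
move=> triG k B k4 [c /bij_inj c_inj adjc].
apply: (triangulated_cycle (c := fun i => val (val (c i))) triG k4) => [i j|//].
by move=> /val_inj/val_inj/c_inj.
Qed.

Lemma contains_odd_sun_induced (G : sgraph) (A : {set G}) :
  contains_odd_sun (induced A) -> contains_odd_sun G.
Proof.
case=> k [B [odd_k [k3 [v [u [vu_bij adjv adju]]]]]].
have vu_inj := bij_inj vu_bij.
have v_inj : injective v by move=> i j E; case: (vu_inj (inl i) (inl j) E).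
have u_inj : injective u by move=> i j E; case: (vu_inj (inr i) (inr j) E).
have vu i j : v i != u j by apply/eqP=> E; have := vu_inj (inl i) (inr j) E.
have val2_inj : injective (fun x : induced B => val (val x)) by move=> x y /val_inj/val_inj.
have [C sunC] : exists C : {set G}, is_sun k (induced C).
  apply: (@is_sun_induced G k (fun i => val (val (v i))) (fun i => val (val (u i)))) => //.
  - by move=> i j /val2_inj/v_inj.
  - by move=> i j /val2_inj/u_inj.
  - move=> i j; rewrite -!(inj_eq v_inj); exact: adju.
  by move=> i j; have := adju i (u j); rewrite ![u j == _]eq_sym !(negPf (vu _ _)) => /negbT.
by exists k, C.
Qed.

Theorem theorem2p2 (G : sgraph) (triG : triangulated G) :
  S_perfect G <-> ~ contains_odd_sun G.
Proof.
split=> [perfG [k [A [odd_k sunA]]]|sun_free A].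
  by have := odd_sun_gap odd_k sunA; rewrite perfG ltnn.
apply: alpha_S_theta_S; first exact: triangulated_induced.
by move/contains_odd_sun_induced.
Qed.
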